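(* For any integer $q\ge 1$, let $m(q,k)$ and $m'(q,k)$ denote the maximum number of pairs in a strong, respectively weak, $(q+1)$-sum $(k,k)$-system in $\{0,1,\dots,q\}^{<\mathbb{N}}$. Then \[ \lim_{k\to\infty}\sqrt[k]{m(q,k)}=\lim_{k\to\infty}\sqrt[k]{m'(q,k)}=(\sqrt{q}+1)^2. \]
   Context: Let $Q=\{0,1,\dots,q\}$ and let $Q^{<\mathbb{N}}$ denote the set of infinite sequences $\mathbf{x}=(x_1,x_2,\dots)$ with entries in $Q$ and finite support $S_{\mathbf{x}}=\{i:x_i\neq 0\}$. For $s\ge 1$ and $\mathbf{x},\mathbf{y}\in Q^{<\mathbb{N}}$, put $|\mathbf{x}\cap_s\mathbf{y}|=|\{i: x_i+y_i\ge s\}|$. A system $\{(\mathbf{x}^j,\mathbf{y}^j): j=1,\dots,m\}$ of pairs in $Q^{<\mathbb{N}}\times Q^{<\mathbb{N}}$ with $|\mathbf{x}^j\cap_s\mathbf{y}^j|=0$ for all $j$ is a strong $s$-sum IVP-system if $|\mathbf{x}^i\cap_s\mathbf{y}^j|\neq 0$ for all $i\neq j$, and a weak $s$-sum IVP-system if for all $i\neq j$ at least one of $|\mathbf{x}^i\cap_s\mathbf{y}^j|\neq0$, $|\mathbf{x}^j\cap_s\mathbf{y}^i|\neq 0$ holds. It is an $(a,b)$-system if moreover $|S_{\mathbf{x}^j}|\le a$ and $|S_{\mathbf{y}^j}|\le b$ for all $j$. *)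

(* Defs.v *)
From HB Require Import structures.
From mathcomp Require Import all_boot all_order all_algebra.
From mathcomp Require Import finmap.
From mathcomp Require Import all_classical all_reals all_analysis.

Set Implicit Arguments.
Unset Strict Implicit.
Unset Printing Implicit Defensive.

(* Coordinates are numbered from 0; [finsupp x] is the support of [x]. *)
Definition fin_seq (q : nat) := {fsfun nat -> 'I_q.+1 with ord0}.

(* Restricting the index to the union of the two supports loses nothing as
   soon as s >= 1, see [in_sum_inter] below. *)
Definition sum_inter (q s : nat) (x y : fin_seq q) : {fset nat} :=
  [fset i in (finsupp x `|` finsupp y)%fset | s <= x i + y i]%fset.

Lemma in_sum_inter (q s : nat) (x y : fin_seq q) (i : nat) :
  0 < s -> (i \in sum_inter s x y) = (s <= x i + y i).
Proof.
move=> s_gt0; rewrite !inE /= andb_idl // => le_s.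
rewrite !mem_finsupp -negb_and; apply: contraL le_s => /andP[/eqP-> /eqP->].
by rewrite -ltnNge.
Qed.

(* Systems are families indexed by 'I_m; in a strong or weak system the pairs
   are automatically pairwise distinct, because each pair is s-disjoint, so
   this agrees with sets of m pairs. *)
Definition sdisjoint_pairs (q s m : nat) (F : 'I_m -> fin_seq q * fin_seq q) :=
  forall j, #|` sum_inter s (F j).1 (F j).2| = 0.

Definition strong_IVP (q s m : nat) (F : 'I_m -> fin_seq q * fin_seq q) :=
  sdisjoint_pairs s F /\
  forall i j, i != j -> #|` sum_inter s (F i).1 (F j).2| <> 0.

Definition weak_IVP (q s m : nat) (F : 'I_m -> fin_seq q * fin_seq q) :=
  sdisjoint_pairs s F /\
  forall i j, i != j ->
    #|` sum_inter s (F i).1 (F j).2| <> 0 \/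
    #|` sum_inter s (F j).1 (F i).2| <> 0.

Definition ab_bounded (q a b m : nat) (F : 'I_m -> fin_seq q * fin_seq q) :=
  forall j, #|` finsupp (F j).1| <= a /\ #|` finsupp (F j).2| <= b.

Definition is_max_size (T : Type) (P : forall m : nat, ('I_m -> T) -> Prop)
    (n : nat) :=
  (exists F : 'I_n -> T, P n F) /\
  (forall (m : nat) (F : 'I_m -> T), P m F -> m <= n).

Lemma is_max_size_unique (T : Type) (P : forall m : nat, ('I_m -> T) -> Prop)
    (n n' : nat) : is_max_size P n -> is_max_size P n' -> n = n'.
Proof.
move=> [[F PF] maxn] [[F' PF'] maxn']; apply/eqP.
by rewrite eqn_leq (maxn' _ _ PF) (maxn _ _ PF').
Qed.

Definition is_max_strong (q s a b n : nat) :=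
  is_max_size (fun m (F : 'I_m -> fin_seq q * fin_seq q) =>
    strong_IVP s F /\ ab_bounded a b F) n.

Definition is_max_weak (q s a b n : nat) :=
  is_max_size (fun m (F : 'I_m -> fin_seq q * fin_seq q) =>
    weak_IVP s F /\ ab_bounded a b F) n.

(* Main.v *)
(** Put a = 1 / (sqrt q + 1), so that 2 a + (q - 1) a^2 = 1, and draw the
    coordinates of z independently, with mass a on 0 and on q and a^2 on every
    other value.  For a (q+1)-disjoint pair (x, y) the event x <= z <= q - y
    has probability at least a^(|S_x| + |S_y|), and in a weak system these
    events are pairwise disjoint; hence m'(q, k) <= a^(-2k).

    Conversely, every z in {0, ..., q}^n has probability exactly
    a^(|S_z| + |S_{q-z}|).  Sorting the z by (|S_z|, |S_{q-z}|, sum of z), one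
    of the polynomially many classes has probability at least 1 / poly(n), and
    the pairs (z, q - z) with z in that class form a strong system.  The
    product (on disjoint coordinates) of this system with its transpose is
    balanced, and its powers show that m(q, k) is at least (a^(-2) - o(1))^k. *)
Require Import Defs.
From HB Require Import structures.
From mathcomp Require Import all_boot all_order all_algebra.
From mathcomp Require Import finmap.
From mathcomp Require Import all_classical all_reals all_analysis.
From mathcomp Require Import lra zify ring.
Import Order.TTheory GRing.Theory Num.Theory.
Import numFieldNormedType.Exports.
Local Open Scope classical_set_scope.
Local Open Scope ring_scope.

(** * Weights on a single coordinate *)

(** The exponent counts in how many of the supports of [z] and [q - z] a coordinate of value [v]
    lies: for [0 < q], once at the two end values and twice in between. *)
Definition coord_weight {R : realType} {q : nat} (a : R) (v : 'I_q.+1) : R :=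
  a ^+ ((v != ord0) + (v != ord_max)).

Lemma coord_weight_ge0 {R : realType} {q : nat} (a : R) (v : 'I_q.+1) :
  0 <= a -> 0 <= coord_weight a v.
Proof. by move=> a0; rewrite /coord_weight exprn_ge0. Qed.

Lemma sum_coord_weight {R : realType} {q : nat} (a : R) : (0 < q)%N ->
  a *+ 2 + a ^+ 2 *+ q.-1 = 1 -> \sum_(v < q.+1) coord_weight a v = 1.
Proof.
case: q => // q _ /= <-; rewrite big_ord_recl big_ord_recr /=.
rewrite (eq_bigr (fun=> a ^+ 2)) => [|i _]; last first.
  by rewrite /coord_weight -!val_eqE /= /bump /= eqSS !add1n neq_ltn ltn_ord.
rewrite sumr_const card_ord /coord_weight !eqxx -!val_eqE /=.
by rewrite /bump leq0n eqxx !expr1 mulr2n [X in a + X]addrC addrA.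
Qed.

(** If [u] and [v] both vanish, the interval is everything and has mass 1. If exactly one does, it
    contains an end value, of mass [a]. If neither does, [u] lies strictly between 0 and [q] and
    alone contributes [a ^+ 2]. *)
Lemma coord_weight_interval {R : realType} {q : nat} (a : R) (u v : 'I_q.+1) :
  (0 < q)%N -> 0 <= a -> a *+ 2 + a ^+ 2 *+ q.-1 = 1 -> (u + v <= q)%N ->
  a ^+ ((u != ord0) + (v != ord0)) <=
    \sum_(w : 'I_q.+1 | (u <= w <= q - v)%N) coord_weight a w.
Proof.
move=> q0 a0 a1 uvq.
have single (w : 'I_q.+1) : (u <= w <= q - v)%N ->
    coord_weight a w <=
    \sum_(w : 'I_q.+1 | (u <= w <= q - v)%N) coord_weight a w.
  move=> w_in; rewrite (bigD1 w) //= lerDl sumr_ge0 // => *.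
  exact: coord_weight_ge0.
have [u0|u0] := eqVneq u ord0; have [v0|v0] := eqVneq v ord0.
- rewrite u0 v0 subn0 /= expr0 -(sum_coord_weight _ q0 a1).
  rewrite [leRHS](eq_bigl predT) // => w /=.
  by rewrite -ltnS ltn_ord.
- apply: le_trans (single ord0 _); last by rewrite u0 /=.
  by rewrite /coord_weight eqxx -val_eqE /= neq_ltn q0.
- apply: le_trans (single ord_max _).
    by rewrite /coord_weight eqxx -val_eqE /= -lt0n q0.
  by rewrite v0 /= subn0 leqnn andbT -ltnS.
- have vpos : (0 < v)%N by rewrite lt0n.
  apply: le_trans (single u _); last by rewrite leqnn /=; lia.
  suff -> : coord_weight a u = a ^+ 2 by [].
  rewrite /coord_weight u0 -val_eqE /= neq_ltn.
  by have -> : (u < q)%N by lia.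
Qed.

(** * Upper bound for weak systems on a finite coordinate set *)

Definition nonzeros {q : nat} {I : finType} (x : I -> 'I_q.+1) : nat :=
  #|[pred i | x i != ord0]|.

Lemma nonzerosE {q : nat} {I : finType} (x : I -> 'I_q.+1) :
  nonzeros x = (\sum_i (x i != ord0))%N.
Proof.
rewrite /nonzeros -sum1_card big_mkcond; apply: eq_bigr => i _.
by rewrite inE; case: eqP.
Qed.

Lemma weak_family_card {R : realType} {q : nat} (a : R) (I T : finType)
    (x y : T -> I -> 'I_q.+1) (b c : nat) :
  (0 < q)%N -> 0 <= a <= 1 -> a *+ 2 + a ^+ 2 *+ q.-1 = 1 ->
  (forall t i, (x t i + y t i <= q)%N) ->
  (forall t t', t != t' ->
    exists i, (q < x t i + y t' i)%N || (q < x t' i + y t i)%N) ->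
  (forall t, nonzeros (x t) <= b /\ nonzeros (y t) <= c)%N ->
  #|T|%:R * a ^+ (b + c) <= 1.
Proof.
move=> q0 /andP[a0 a_le1] a1 dis cross bnd.
pose W (f : {ffun I -> 'I_q.+1}) := \prod_i coord_weight a (f i).
pose E t (f : {ffun I -> 'I_q.+1}) := [forall i, (x t i <= f i <= q - y t i)%N].
have W0 f : 0 <= W f by apply: prodr_ge0 => i _; exact: coord_weight_ge0.
(* A common point gives [x t i <= f i <= q - y t' i] and the same with [t], [t'] exchanged, so no
   coordinate could cross. *)
have E_inj t t' f : E t f -> E t' f -> t = t'.
  move=> /forallP Et /forallP Et'; apply/eqP/negPn/negP => /cross[i].
  by move: (Et i) (Et' i) (dis t i) (dis t' i) => /andP[+ +] /andP[]; lia.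
(* Since [a <= 1], supports smaller than [b] and [c] only help; by independence the event factors
   into coordinate intervals. *)
have E_ge t : a ^+ (b + c) <= \sum_(f | E t f) W f.
  have [xb yc] := bnd t.
  apply: (@le_trans _ _ (a ^+ (nonzeros (x t) + nonzeros (y t)))).
    by apply: ler_wiXn2l => //; exact: leq_add.
  rewrite !nonzerosE -big_split /= -prodrXr.
  have -> : \sum_(f | E t f) W f =
      \prod_i \sum_(w : 'I_q.+1 | (x t i <= w <= q - y t i)%N) coord_weight a w.
    by rewrite bigA_distr_big_dep.
  apply: ler_prod => i _; rewrite exprn_ge0 //=.
  exact: coord_weight_interval.
apply: (@le_trans _ _ (\sum_(f : {ffun I -> 'I_q.+1}) W f)); last first.
  have -> : \sum_(f : {ffun I -> 'I_q.+1}) W f =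
      \prod_(i : I) \sum_(v < q.+1) coord_weight a v.
    by rewrite bigA_distr_bigA.
  rewrite (eq_bigr (fun=> 1)) ?big1_eq // => i _.
  exact: sum_coord_weight.
rewrite mulr_natl -sumr_const.
apply: (@le_trans _ _ (\sum_(t in T) \sum_(f | E t f) W f)).
  by apply: ler_sum => t _; exact: E_ge.
rewrite (exchange_big_dep predT) //=; apply: ler_sum => f _.
have [t Et|none] := pickP (E^~ f).
  rewrite (big_pred1 t) // => t' /=; apply/idP/eqP => [|-> //].
  by move=> Et'; exact: E_inj Et' Et.
by rewrite big_pred0.
Qed.

(** * Strong systems on finite coordinate sets and their products *)

(** Coordinates and indices range over arbitrary finite types, so that juxtaposing two systems uses
    [I + I'] and [T * T'] without renumbering. *)
Definition strong_size (q b c m : nat) : Prop :=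
  exists (I T : finType) (x y : T -> I -> 'I_q.+1),
    [/\ #|T| = m, forall t i, (x t i + y t i <= q)%N,
        forall t t', t != t' -> exists i, (q < x t i + y t' i)%N &
        forall t, (nonzeros (x t) <= b /\ nonzeros (y t) <= c)%N].

Lemma strong_size_trivial (q : nat) : strong_size q 0 0 1.
Proof.
exists void, unit, (fun _ _ => ord0), (fun _ _ => ord0).
split=> [||[] []|_] //; first exact: card_unit.
by rewrite nonzerosE big1 // => -[].
Qed.

Lemma strong_size_swap (q b c m : nat) :
  strong_size q b c m -> strong_size q c b m.
Proof.
move=> [I [T [x [y [Tm dis cross bnd]]]]]; exists I, T, y, x; split => //.
- by move=> t i; rewrite addnC.
- by move=> t t'; rewrite eq_sym => /cross[i]; exists i; rewrite addnC.
- by move=> t; have [] := bnd t.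
Qed.

Lemma strong_size_le (q b c b' c' m : nat) : (b <= b')%N -> (c <= c')%N ->
  strong_size q b c m -> strong_size q b' c' m.
Proof.
move=> bb cc [I [T [x [y [Tm dis cross bnd]]]]]; exists I, T, x, y.
split=> // t; have [xb yc] := bnd t.
by split; [apply: leq_trans xb bb|apply: leq_trans yc cc].
Qed.

(** Distinct index pairs differ in some component, and a crossing coordinate of that component
    serves; support sizes add. *)
Lemma strong_sizeM (q b c m b' c' m' : nat) :
  strong_size q b c m -> strong_size q b' c' m' ->
  strong_size q (b + b') (c + c') (m * m').
Proof.
move=> [I [T [x [y [Tm dis cross bnd]]]]].
move=> [I' [T' [x' [y' [Tm' dis' cross' bnd']]]]].
pose glue (u : T -> I -> 'I_q.+1) (u' : T' -> I' -> 'I_q.+1) (t : T * T')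
  (i : I + I') := match i with inl i => u t.1 i | inr i => u' t.2 i end.
exists (I + I')%type, (T * T')%type, (glue x x'), (glue y y'); split.
- by rewrite card_prod Tm Tm'.
- by move=> [t t'] [i|i] /=.
- move=> [t t'] [s s']; rewrite xpair_eqE negb_and.
  move=> /orP[/cross|/cross'][i xy].
    by exists (inl i).
  by exists (inr i).
- move=> [t t']; have [xb yc] := bnd t; have [xb' yc'] := bnd' t'.
  by rewrite !nonzerosE !big_sumType /= -!nonzerosE; split; exact: leq_add.
Qed.

Lemma strong_sizeX (q b c m n : nat) :
  strong_size q b c m -> strong_size q (n * b) (n * c) (m ^ n).
Proof.
move=> sm; elim: n => [|n IHn]; first exact: strong_size_trivial.
by rewrite !mulSn expnS; exact: strong_sizeM.
Qed.

(** * Large strong systems by pigeonhole *)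

Lemma rev_ord_eq0 {q : nat} (v : 'I_q.+1) :
  (rev_ord v == ord0) = (v == ord_max).
Proof.
by rewrite -!val_eqE /= subSS subn_eq0 eqn_leq -[(v <= q)%N]ltnS ltn_ord.
Qed.

(* The pairs are (z, q - z) with z in {0, ..., q}^n; two sequences with the
   same coordinate sum are never comparable unless they are equal. *)
Lemma strong_size_pigeonhole {R : realType} {q : nat} (a : R) (n : nat) :
  (0 < q)%N -> 0 <= a -> a *+ 2 + a ^+ 2 *+ q.-1 = 1 ->
  exists b c m, [/\ strong_size q b c m, (n <= b + c)%N &
    1 <= m%:R * a ^+ (b + c) * (n.+1 * n.+1 * (n * q).+1)%:R].
Proof.
move=> q0 a0 a1.
pose Z := {ffun 'I_n -> 'I_q.+1}.
pose rev (z : Z) i := rev_ord (z i).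
pose K := ('I_n.+1 * 'I_n.+1 * 'I_(n * q).+1)%type.
have nz_le (u : 'I_n -> 'I_q.+1) : (nonzeros u < n.+1)%N.
  by rewrite ltnS /nonzeros -[leqRHS]card_ord max_card.
have sum_le (z : Z) : (\sum_i z i < (n * q).+1)%N.
  rewrite ltnS -[X in (_ <= X * _)%N]card_ord -sum_nat_const.
  by apply: leq_sum => i _; rewrite -ltnS.
pose key (z : Z) : K :=
  (Ordinal (nz_le z), Ordinal (nz_le (rev z)), Ordinal (sum_le z)).
pose W (z : Z) := \prod_i coord_weight a (z i).
have WE (z : Z) : W z = a ^+ (nonzeros z + nonzeros (rev z)).
  rewrite !nonzerosE -big_split /= -prodrXr.
  by apply: eq_bigr => i _; rewrite /coord_weight rev_ord_eq0.
have cardK : #|{: K}| = (n.+1 * n.+1 * (n * q).+1)%N.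
  by rewrite !card_prod !card_ord.
have W1 : \sum_(z : Z) W z = 1.
  have -> : \sum_(z : Z) W z = \prod_(i < n) \sum_(v < q.+1) coord_weight a v.
    by rewrite bigA_distr_bigA.
  rewrite (eq_bigr (fun=> 1)) ?big1_eq // => i _.
  exact: sum_coord_weight.
(* Averaging: were every class lighter than the inverse number of classes, the total mass would be
   below 1. *)
have [k k_ge] : exists k : K, 1 <= (\sum_(z | key z == k) W z) * #|{: K}|%:R.
  apply: contrapT => /forallNP small.
  have : \sum_(k : K) (\sum_(z | key z == k) W z) * #|{: K}|%:R <
      \sum_(k : K) 1.
    apply: ltr_sum => [|k _]; last by rewrite ltNge; apply/negP/small.
    by apply/hasP; exists (ord0, ord0, ord0); rewrite ?mem_index_enum.
  have key1 : \sum_(k : K) \sum_(z | key z == k) W z = 1.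
    by rewrite -W1 (partition_big key predT).
  by rewrite -mulr_suml key1 mul1r sumr_const ltxx.
pose T := {z : Z | key z == k}.
exists k.1.1, k.1.2, #|{: T}|; split.
- exists 'I_n, T, (fun (t : T) i => sval t i), (fun t => rev (sval t)).
  split=> //.
  + by move=> [z zk] i /=; rewrite subSS subnKC // -ltnS.
  + move=> [z /= zk] [z' /= zk'] neq.
    apply: contrapT => /forallNP le_zz'.
    have /leqif_sum : forall i : 'I_n, true ->
        (z i <= z' i ?= iff (z i == z' i))%N.
      move=> i _; apply/leqif_eq; have /negP := le_zz' i.
      rewrite -leqNgt /= subSS.
      by have := ltn_ord (z' i); lia.
    have [_ _ sum_eq] : key z = key z' by rewrite (eqP zk) (eqP zk').
    move=> [_]; rewrite sum_eq eqxx => /esym/forallP /= eq_zz'.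
    move: neq; rewrite -val_eqE /= => /eqP; apply.
    by apply/ffunP => i; apply/eqP; rewrite eq_zz'.
  + by move=> [z /= /eqP <-].
(* The chosen class has positive mass, hence a member [z]. As 0 and [q] differ, each coordinate lies
   in the support of [z] or of [q - z], so these sizes sum to at least [n]. *)
- case: (pickP (fun z => key z == k)) => [z /eqP <- /=|none]; last first.
    by move: k_ge; rewrite big_pred0 // mul0r ler10.
  rewrite !nonzerosE -big_split /= -[leqLHS]card_ord -sum1_card.
  apply: leq_sum => i _; rewrite rev_ord_eq0.
  by case: eqVneq => // ->; rewrite -val_eqE /= neq_ltn q0.
- rewrite -cardK; apply: le_trans k_ge _; rewrite ler_wpM2r //.
  rewrite (eq_bigr (fun=> a ^+ (k.1.1 + k.1.2))).
    by rewrite sumr_const card_sig mulr_natl.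
  by move=> z /eqP <-.
Qed.

(** Multiplying by the transpose squares the estimate. The bound [n <= s] later lets an exponential
    in [s] absorb the polynomial loss in [n]. *)
Lemma strong_size_balanced {R : realType} {q : nat} (a : R) (n : nat) :
  (0 < q)%N -> 0 <= a -> a *+ 2 + a ^+ 2 *+ q.-1 = 1 ->
  exists s m, [/\ strong_size q s s m, (n <= s)%N &
    1 <= m%:R * (a ^+ 2) ^+ s * (q.+1 * n.+1 ^ 3)%:R ^+ 2].
Proof.
move=> q0 a0 a1.
have [b [c [m [sm nbc m_ge]]]] := strong_size_pigeonhole a n q0 a0 a1.
exists (b + c)%N, (m * m)%N; split => //.
  have := strong_sizeM _ _ _ _ _ _ _ sm (strong_size_swap _ _ _ _ sm).
  by rewrite [(c + b)%N]addnC.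
(* Here [n * q + 1] is at most [(q + 1) * (n + 1)]. *)
have {}m_ge : 1 <= m%:R * a ^+ (b + c) * (q.+1 * n.+1 ^ 3)%:R.
  apply: le_trans m_ge _; rewrite ler_wpM2l ?mulr_ge0 ?exprn_ge0 //.
  rewrite ler_nat; nia.
rewrite -exprM mulnC exprM natrM -expr2 -!exprMn.
exact: exprn_ege1.
Qed.

(** * Transfer to and from finitely supported sequences *)

Lemma sum_inter_eq0P {q : nat} (x y : fin_seq q) :
  #|` sum_inter q.+1 x y| = 0%N <-> forall i, (x i + y i <= q)%N.
Proof.
split=> [/cardfs0_eq xy0 i|xy_le].
  by rewrite leqNgt -in_sum_inter // xy0 inE.
apply/eqP; rewrite cardfs_eq0; apply/eqP/fsetP => i.
by rewrite in_sum_inter // ltnNge xy_le inE.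
Qed.

Lemma sum_inter_neq0P {q : nat} (x y : fin_seq q) :
  #|` sum_inter q.+1 x y| <> 0%N <-> exists i, (q < x i + y i)%N.
Proof.
rewrite sum_inter_eq0P; split=> [/existsNP[i /negP]|[i xyi] /(_ i)].
  by rewrite -ltnNge; exists i.
by rewrite leqNgt xyi.
Qed.

(** [choice.pickle] embeds [I] into the positions. On its image [choice.unpickle] succeeds, so the
    [ord0] inside [oapp] is never reached. *)
Definition fin_seq_of {q : nat} {I : finType} (x : I -> 'I_q.+1) : fin_seq q :=
  [fsfun j in [fset choice.pickle i | i in enum I]%fset =>
    oapp x ord0 (choice.unpickle j)].

Lemma fin_seq_ofE {q : nat} {I : finType} (x : I -> 'I_q.+1) (i : I) :
  fin_seq_of x (choice.pickle i) = x i.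
Proof. by rewrite fsfunE in_imfset /= ?mem_enum ?choice.pickleK. Qed.

Lemma fin_seq_of_notin {q : nat} {I : finType} (x : I -> 'I_q.+1) (j : nat) :
  (forall i : I, j <> choice.pickle i) -> fin_seq_of x j = ord0.
Proof.
by move=> jI; rewrite fsfunE; case: imfsetP => //= -[i _ /jI].
Qed.

Lemma card_finsupp_fin_seq_of {q : nat} {I : finType} (x : I -> 'I_q.+1) :
  (#|` finsupp (fin_seq_of x)| <= nonzeros x)%N.
Proof.
have -> : nonzeros x =
    #|` [fset choice.pickle i | i in [pred i | x i != ord0]]%fset|.
  by rewrite card_imfset /=; [rewrite -cardE|exact: pcan_inj choice.pickleK].
apply/fsubset_leq_card/fsubsetP => j; rewrite mem_finsupp => xj.
have [[i ji]|/forallNP jI] := pselect (exists i : I, j = choice.pickle i).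
  by rewrite ji fin_seq_ofE in xj *; exact: in_imfset.
by rewrite fin_seq_of_notin // eqxx in xj.
Qed.

Lemma strong_size_IVP (q b c m : nat) : strong_size q b c m ->
  exists F : 'I_m -> fin_seq q * fin_seq q,
    strong_IVP q.+1 F /\ ab_bounded b c F.
Proof.
move=> [I [T [x [y [<- dis cross bnd]]]]].
exists (fun j => (fin_seq_of (x (enum_val j)), fin_seq_of (y (enum_val j)))).
split; first split.
- move=> j /=; apply/sum_inter_eq0P => i.
  have [[k ->]|/forallNP iI] := pselect (exists k : I, i = choice.pickle k).
    by rewrite !fin_seq_ofE.
  by rewrite !fin_seq_of_notin.
- move=> i j ij /=; apply/sum_inter_neq0P.
  have /cross[k xyk] : enum_val i != enum_val j.
    by rewrite (inj_eq enum_val_inj).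
  by exists (choice.pickle k); rewrite !fin_seq_ofE.
- move=> j /=; have [xb yc] := bnd (enum_val j).
  by split; [apply: leq_trans xb|apply: leq_trans yc];
    exact: card_finsupp_fin_seq_of.
Qed.

Lemma strong_IVP_weak (q s m : nat) (F : 'I_m -> fin_seq q * fin_seq q) :
  strong_IVP s F -> weak_IVP s F.
Proof. by move=> [dis cross]; split=> // i j ij; left; exact: cross. Qed.

Lemma nonzeros_fset_sub {q : nat} (x : fin_seq q) (U : {fset nat}) :
  (nonzeros (fun i : U => x (val i)) <= #|` finsupp x|)%N.
Proof.
have -> : nonzeros (fun i : U => x (val i)) =
    #|` [fset val i | i in [pred i : U | x (val i) != ord0]]%fset|.
  by rewrite card_imfset /=; [rewrite -cardE|exact: val_inj].
apply/fsubset_leq_card/fsubsetP => j /imfsetP[i /= xi ->].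
by rewrite mem_finsupp.
Qed.

(** The pairs are restricted to the finite union [U] of all supports. No crossing is lost, because a
    position where both entries vanish cannot cross. *)
Lemma weak_IVP_size {R : realType} {q : nat} (a : R) (m b c : nat)
    (F : 'I_m -> fin_seq q * fin_seq q) :
  (0 < q)%N -> 0 <= a <= 1 -> a *+ 2 + a ^+ 2 *+ q.-1 = 1 ->
  weak_IVP q.+1 F -> ab_bounded b c F -> m%:R * a ^+ (b + c) <= 1.
Proof.
move=> q0 a01 a1 [dis cross] bnd.
pose U := (\bigcup_(j <- index_enum 'I_m)
  (finsupp (F j).1 `|` finsupp (F j).2))%fset.
have suppU j i : (F j).1 i != ord0 \/ (F j).2 i != ord0 -> i \in U.
  rewrite -!mem_finsupp => ij.
  have /fsubsetP : (finsupp (F j).1 `|` finsupp (F j).2 `<=` U)%fset.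
    by apply: bigfcup_sup; rewrite ?mem_index_enum.
  by apply; rewrite in_fsetU; apply/orP.
have witness j j' : (exists i, q < (F j).1 i + (F j').2 i)%N ->
    exists i : U, (q < (F j).1 (val i) + (F j').2 (val i))%N.
  move=> [i qi]; have iU : i \in U.
    have [x0|x0] := eqVneq ((F j).1 i) ord0; last by apply: (suppU j); left.
    apply: (suppU j'); right; apply: contraL qi => /eqP ->.
    by rewrite x0.
  by exists [` iU]%fset.
rewrite -[m]card_ord.
apply: (@weak_family_card _ q _ U _ (fun j i => (F j).1 (val i))
  (fun j i => (F j).2 (val i))) => //.
- by move=> t i; have /sum_inter_eq0P := dis t; exact.
- move=> t t' /cross[/sum_inter_neq0P|/sum_inter_neq0P] /witness[i qi];
    by exists i; rewrite qi ?orbT.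
- move=> t; have [xb yc] := bnd t.
  by split; [apply: leq_trans xb|apply: leq_trans yc]; exact: nonzeros_fset_sub.
Qed.

(** * Existence of maxima, growth estimates and the limit of roots *)

Lemma is_max_size_ex (T : Type) (P : forall m : nat, ('I_m -> T) -> Prop)
    (N m0 : nat) (F0 : 'I_m0 -> T) : P m0 F0 ->
  (forall (m : nat) (F : 'I_m -> T), P m F -> (m <= N)%N) ->
  exists n, is_max_size P n.
Proof.
move=> P0 PN.
have exP : exists m, `[< exists F : 'I_m -> T, P m F >].
  by exists m0; apply/asboolP; exists F0.
have ubP m : `[< exists F : 'I_m -> T, P m F >] -> (m <= N)%N.
  by move=> /asboolP[F /PN].
case: (ex_maxnP exP ubP) => n /asboolP Pn maxn; exists n; split=> // m F PF.
by apply: maxn; apply/asboolP; exists F.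
Qed.

Lemma bernoulli_ineq {R : realType} (x : R) (n : nat) : 0 <= x ->
  1 + x * n%:R <= (1 + x) ^+ n.
Proof.
move=> x0; elim: n => [|n IHn]; first by rewrite mulr0 addr0 expr0.
rewrite exprS; apply: le_trans (ler_wpM2l _ IHn); last by rewrite addr_ge0.
rewrite -natr1; have : 0 <= x * x * n%:R by rewrite !mulr_ge0.
by nra.
Qed.

Lemma near_le_exprn {R : realType} (x B : R) : 0 < x ->
  \forall k \near \oo, B <= (1 + x) ^+ k.
Proof.
move=> x0; have Bx : 0 <= `|B| / x by rewrite divr_ge0 // ltW.
exists (Num.Def.archi_bound (`|B| / x)) => // k /= Kk.
apply: le_trans (ler_norm B) _; apply: le_trans (bernoulli_ineq _ _ (ltW x0)).
apply: (@le_trans _ _ (x * k%:R)); last by rewrite lerDr.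
rewrite mulrC -ler_pdivrMr //; apply/ltW/(lt_le_trans (archi_boundP Bx)).
by rewrite ler_nat.
Qed.

(** Degree 6 is that of the squared cubic loss in [strong_size_balanced]. With [n = 7 t], Bernoulli
    bounds the right side below by [(x t) ^+ 7], which beats [C (8 t) ^+ 6] once [t] is large. *)
Lemma ex_poly_le_exprn {R : realType} (x C : R) : 0 < x -> 0 <= C ->
  exists2 n : nat, (0 < n)%N & C * n.+1%:R ^+ 6 <= (1 + x) ^+ n.
Proof.
move=> x0 C0; have x7 : 0 < x ^+ 7 by rewrite exprn_gt0.
have B0 : 0 <= C * 8 ^+ 6 / x ^+ 7 by rewrite divr_ge0 ?mulr_ge0 // ltW.
(* The successor makes [t] positive, whence [7 t + 1 <= 8 t]. *)
pose t := (Num.Def.archi_bound (C * 8 ^+ 6 / x ^+ 7)).+1.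
have Ct : C * 8 ^+ 6 <= t%:R * x ^+ 7.
  rewrite -ler_pdivrMr //; apply/ltW/(lt_le_trans (archi_boundP B0)).
  by rewrite ler_nat.
exists (t * 7)%N => //.
rewrite exprM; apply: (@le_trans _ _ ((x * t%:R) ^+ 7)); last first.
  rewrite lerXn2r ?nnegrE ?exprn_ge0 ?addr_ge0 ?mulr_ge0 ?(ltW x0) //.
  by apply: le_trans (bernoulli_ineq _ _ (ltW x0)); rewrite lerDr.
apply: (@le_trans _ _ (C * (8 * t%:R) ^+ 6)).
  rewrite ler_wpM2l // lerXn2r ?nnegrE ?mulr_ge0 // -natrM ler_nat /t.
  by lia.
rewrite !exprMn mulrA [t%:R ^+ 7]exprS mulrA ler_wpM2r ?exprn_ge0 //.
by rewrite [x ^+ 7 * _]mulrC.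
Qed.

(** Choose [c1] strictly between [c] and [L]. A balanced block whose polynomial loss is at most
    [(L / c1) ^+ s] has [N >= c1 ^+ s] pairs. Its power of exponent [k %/ s] fits into supports of
    size [k], and rounding costs at most a factor [c1 ^+ s], absorbed by [(c1 / c) ^+ k] for large
    [k]. *)
Lemma near_strong_size {R : realType} {q : nat} (a : R) (m : nat -> nat)
    (c : R) :
  (0 < q)%N -> 0 < a < 1 -> a *+ 2 + a ^+ 2 *+ q.-1 = 1 ->
  (forall k n, strong_size q k k n -> (n <= m k)%N) ->
  0 < c < a ^- 2 -> \forall k \near \oo, c ^+ k <= (m k)%:R.
Proof.
move=> q0 /andP[a0 a_lt1] a1 m_max /andP[c0 cL].
have a20 : 0 < a ^+ 2 by rewrite exprn_gt0.
set L := a ^- 2 in cL *.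
have L1 : 1 < L by rewrite /L invf_gt1 // expr_lt1 // ltW.
(* The maximum with 1 forces [1 < c1], so that powers of [c1] increase with the exponent. *)
pose c1 := (Num.max c 1 + L) / 2.
have max_lt : Num.max c 1 < L by rewrite gt_max cL L1.
have [c_c1 c1_gt1] : c < c1 /\ 1 < c1.
  have [] : c <= Num.max c 1 /\ 1 <= Num.max c 1 by rewrite !le_max !lexx orbT.
  by rewrite /c1; move: max_lt; set M := Num.max c 1; split; lra.
have c1L : c1 < L by rewrite /c1; move: max_lt; set M := Num.max c 1; lra.
have c10 : 0 < c1 by exact: lt_trans c_c1.
clearbody c1; pose x := L / c1 - 1.
have x0 : 0 < x by rewrite subr_gt0 ltr_pdivlMr // mul1r.
have xE : 1 + x = L / c1 by rewrite /x addrC subrK.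
have C0 : 0 <= q.+1%:R ^+ 2 :> R by rewrite exprn_ge0.
have [n n0 n_ge] := ex_poly_le_exprn x _ x0 C0.
have [s [N [sN ns N_ge]]] := strong_size_balanced a n q0 (ltW a0) a1.
have s0 : (0 < s)%N by exact: leq_trans ns.
have c1N : c1 ^+ s <= N%:R.
  have {}N_ge : 1 <= N%:R * (a ^+ 2) ^+ s * (L / c1) ^+ s.
    apply: le_trans N_ge _; rewrite ler_wpM2l ?mulr_ge0 ?exprn_ge0 ?(ltW a0) //.
    rewrite natrM natrX exprMn -exprM; apply: le_trans n_ge _; rewrite xE.
    by apply: ler_weXn2l ns; rewrite -xE lerDl ltW.
  move: N_ge; rewrite -mulrA -exprMn /L mulrA divff ?gt_eqF // mul1r exprVn.
  by rewrite ler_pdivlMr ?exprn_gt0 // mul1r.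
have y0 : 0 < c1 / c - 1 by rewrite subr_gt0 ltr_pdivlMr // mul1r.
apply: filterS (near_le_exprn _ (c1 ^+ s) y0) => k.
rewrite addrC subrK expr_div_n ler_pdivlMr ?exprn_gt0 // => c1_ge.
have size_k : (N ^ (k %/ s) <= m k)%N.
  apply: m_max; apply: strong_size_le (strong_sizeX _ _ _ _ (k %/ s) sN);
    exact: leq_trunc_div.
rewrite -(ler_pM2l (exprn_gt0 s c10)); apply: le_trans c1_ge _.
apply: (@le_trans _ _ (c1 ^+ s * (N ^ (k %/ s))%:R)); last first.
  by rewrite ler_wpM2l ?exprn_ge0 ?ler_nat // ltW.
apply: (@le_trans _ _ (c1 ^+ (s + s * (k %/ s)))).
  apply: ler_weXn2l; first exact: ltW.
  by rewrite [in leqLHS](divn_eq k s) addnC mulnC leq_add2r ltnW // ltn_pmod.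
rewrite exprD exprM natrX ler_wpM2l ?exprn_ge0 ?(ltW c10) //.
by rewrite lerXn2r ?nnegrE ?exprn_ge0 ?(ltW c10).
Qed.

Lemma cvg_nth_root {R : realType} (L : R) (u : nat -> nat) : 0 < L ->
  (forall k, (u k)%:R <= L ^+ k) ->
  (forall c, 0 < c < L -> \forall k \near \oo, c ^+ k <= (u k)%:R) ->
  ((u k)%:R : R) `^ (k%:R)^-1 @[k --> \oo] --> L.
Proof.
move=> L0 u_le u_ge.
(* At [k = 0] the exponent would be the conventional inverse 0, so [k] must be positive. *)
have rootK (c : R) k : 0 <= c -> (0 < k)%N -> (c ^+ k) `^ (k%:R)^-1 = c.
  move=> c0 k0; rewrite -powR_mulrn // -powRrM divff ?powRr1 //.
  by rewrite pnatr_eq0 -lt0n.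
apply/cvgrPdist_le => /= eps eps0.
(* [L - eps] may be negative; [L / 2] keeps [c] positive. *)
pose c := Num.max (L / 2) (L - eps).
have c0 : 0 < c by rewrite lt_max divr_gt0.
have cL : c < L.
  by rewrite gt_max ltr_pdivrMr // mulr_natr mulr2n ltrDl L0 gtrBl.
have c_cL : 0 < c < L by rewrite c0.
near=> k.
have k0 : (0 < k)%N by near: k; exact: nbhs_infty_gt.
have ck : c ^+ k <= (u k)%:R by near: k; exact: u_ge.
have root_mono (v w : R) : 0 <= v -> v <= w -> v `^ (k%:R)^-1 <= w `^ (k%:R)^-1.
  move=> v0 vw; apply: ge0_ler_powR => //; rewrite ?nnegrE ?invr_ge0 //.
  exact: le_trans vw.
have upper := root_mono _ _ (ler0n R (u k)) (u_le k).
have lower := root_mono _ _ (exprn_ge0 k (ltW c0)) ck.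
rewrite rootK ?(ltW L0) // in upper; rewrite rootK ?(ltW c0) // in lower.
rewrite ger0_norm ?subr_ge0 // lerBlDl -lerBlDr.
by apply: le_trans lower; rewrite le_max lexx orbT.
Unshelve. all: by end_near. Qed.

(** * Existence and growth rate of both maxima *)

Theorem theorem1p9 (R : realType) (q : nat) (hq : (1 <= q)%N) :
  exists m m' : nat -> nat,
    [/\ forall k : nat, is_max_strong q q.+1 k k (m k),
        forall k : nat, is_max_weak q q.+1 k k (m' k),
        ((m k)%:R : R) `^ (k%:R)^-1 @[k --> \oo] -->
          (Num.sqrt (q%:R : R) + 1) ^+ 2 &
        ((m' k)%:R : R) `^ (k%:R)^-1 @[k --> \oo] -->
          (Num.sqrt (q%:R : R) + 1) ^+ 2].
Proof.
pose r : R := Num.sqrt q%:R.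
have r2 : r ^+ 2 = q%:R by rewrite sqr_sqrtr.
have r0 : 0 < r by rewrite sqrtr_gt0 ltr0n.
pose a := (r + 1)^-1.
have r1_gt0 : 0 < r + 1 by rewrite addr_gt0.
have a0 : 0 < a by rewrite invr_gt0.
have a_lt1 : a < 1 by rewrite invf_lt1 // ltrDr.
(* Times [(r + 1) ^+ 2] this reads [2 (r + 1) + r ^+ 2 - 1 = (r + 1) ^+ 2]. *)
have a1 : a *+ 2 + a ^+ 2 *+ q.-1 = 1.
  rewrite -[a ^+ 2 *+ _]mulr_natr -subn1 natrB // -r2 /a.
  by field; rewrite gt_eqF.
have LE : (r + 1) ^+ 2 = a ^- 2 by rewrite /a exprVn invrK.
have a_in : 0 < a < 1 by rewrite a0.
have a01 : 0 <= a <= 1 by rewrite !ltW.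
have weak_le k n (F : 'I_n -> fin_seq q * fin_seq q) :
    weak_IVP q.+1 F /\ ab_bounded k k F -> n%:R <= ((r + 1) ^+ 2) ^+ k.
  move=> [wF bF]; have := weak_IVP_size a _ _ _ _ hq a01 a1 wF bF.
  rewrite addnn -mul2n exprM -ler_pdivlMr ?exprn_gt0 // mul1r -exprVn.
  by rewrite LE.
have strong_weak k n (F : 'I_n -> fin_seq q * fin_seq q) :
    strong_IVP q.+1 F /\ ab_bounded k k F ->
    weak_IVP q.+1 F /\ ab_bounded k k F.
  by move=> [/strong_IVP_weak].
pose B k := Num.Def.archi_bound (((r + 1) ^+ 2) ^+ k).
have weak_leB k n (F : 'I_n -> fin_seq q * fin_seq q) :
    weak_IVP q.+1 F /\ ab_bounded k k F -> (n <= B k)%N.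
  move=> /weak_le nk; rewrite -(ler_nat R); apply: le_trans nk _.
  by apply/ltW/archi_boundP; rewrite !exprn_ge0 // ltW.
(* A single pair with empty supports is admissible for every [k], so the maxima are taken over
   nonempty sets. *)
have [F0 [sF0 bF0]] := strong_size_IVP _ _ _ _ (strong_size_trivial q).
have bF k : ab_bounded k k F0.
  by move=> j; have [] := bF0 j; rewrite !leqn0 => /eqP -> /eqP ->.
have /choice[m m_max] k : exists n, is_max_strong q q.+1 k k n.
  apply: (@is_max_size_ex _ _ (B k) _ F0); first by split.
  by move=> n F /strong_weak; exact: weak_leB.
have /choice[m' m'_max] k : exists n, is_max_weak q q.+1 k k n.
  apply: (@is_max_size_ex _ _ (B k) _ F0); last by move=> n F; exact: weak_leB.
  by split=> //; exact: strong_IVP_weak.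
exists m, m'; split=> //; apply: cvg_nth_root; rewrite ?exprn_gt0 //.
- by move=> k; have [[F /strong_weak /weak_le]] := m_max k.
- rewrite -/r LE => c; apply: (near_strong_size a _ _ hq a_in a1).
  move=> k n /strong_size_IVP[F PF].
  by have [_ /(_ _ _ PF)] := m_max k.
- by move=> k; have [[F /weak_le]] := m'_max k.
- rewrite -/r LE => c; apply: (near_strong_size a _ _ hq a_in a1).
  move=> k n /strong_size_IVP[F /strong_weak PF].
  by have [_ /(_ _ _ PF)] := m'_max k.
Qed.
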